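(* For every $231$-avoiding permutation $\pi$ there is an odd-special Dyck path $P$ such that $\pi(P)=\pi$, where $\pi(P)$ denotes the permutation recording the order in which horizontal steps are created when $P$ is transformed into a big Schröder path by repeated application of $E$.
   Context: **Paths.** All lattice paths start at $(0,0)$, end on the $x$-axis, never go below the $x$-axis, and consist of upsteps U $=(1,1)$, downsteps $(1,-1)$, and double horizontal steps HH $=(2,0)$ (each an indivisible ''horizontal step''). Each downstep is either ordinary (D) or carries the label ''special'' (d). A Dyck path has no horizontal steps. An odd-special Dyck path is a Dyck path in which an arbitrary subset of the downsteps leaving from odd height are labeled special. **Matching upstep.** The upstep matching a downstep $d$ is the rightmost upstep to the left of $d$ that ends at the height from which $d$ leaves. **The map $E$.** If a path has no special steps, $E$ leaves it unchanged. Otherwise take the leftmost special step $s$. (Flatten) If $s$ is immediately preceded by an upstep, replace that upstep and $s$ by one horizontal step HH. (Slide) If $s$ is immediately preceded by a downstep $d$ (necessarily ordinary), let $u$ be the upstep matching $d$ and $Q$ the (possibly empty) subpath strictly between $u$ and $d$; replace the portion $u\,Q\,d\,s$ by HH $Q$ D, with D an ordinary downstep. For paths obtained from odd-special Dyck paths these are the only cases that occur. Each application to a path with a special step creates exactly one new horizontal step and removes one special step; already existing horizontal steps are kept (those in $Q$ move along with $Q$). **The permutation $\pi(P)$.** Let $P$ have $m$ special steps. Apply $E$ $m$ times, giving the label $i$ to the horizontal step created by the $i$th application. The final path has no special steps and $m$ horizontal steps; $\pi(P)$ is the permutation of $\{1,\dots,m\}$, in one-line notation, obtained by reading the labels of its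 horizontal steps from left to right. **Pattern avoidance.** A permutation $\pi_1\cdots\pi_m$ avoids $231$ if there are no indices $i<j<k$ with $\pi_k<\pi_i<\pi_j$. *)

(* Defs.v *)
From mathcomp Require Import all_boot all_order all_algebra all_fingroup.

Set Implicit Arguments.
Unset Strict Implicit.
Unset Printing Implicit Defensive.

Import Order.TTheory GRing.Theory Num.Theory.

(* A horizontal step (2,0) carries the index of the application of the map E
   that created it; Down is an ordinary downstep, Special a labeled one. *)
Inductive step := Up | Down | Special | Horiz of nat.

Definition is_up (s : step) : bool := if s is Up then true else false.
Definition is_down (s : step) : bool :=
  match s with Down | Special => true | _ => false end.
Definition is_special (s : step) : bool :=
  if s is Special then true else false.
Definition is_horiz (s : step) : bool := if s is Horiz _ then true else false.

Definition height (p : seq step) : int :=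
  ((count is_up p)%:Z - (count is_down p)%:Z)%R.

Definition lattice_path (p : seq step) : bool :=
  (height p == 0%R) &&
  all (fun j => (0 <= height (take j p))%R) (iota 0 (size p).+1).

Definition dyck_path (p : seq step) : bool :=
  lattice_path p && ~~ has is_horiz p.

Definition odd_special_dyck_path (p : seq step) : bool :=
  dyck_path p &&
  all (fun j => is_special (nth Down p j) ==> odd `|height (take j p)|)
      (iota 0 (size p)).

(* The position in a of the upstep matching a downstep that immediately
   follows a, and hence leaves from height (height a). *)
Definition matching_up (a : seq step) : option nat :=
  ohead (rev [seq j <- iota 0 (size a) |
               is_up (nth Down a j) && (height (take j.+1 a) == height a)]).

(* One application of E, the created horizontal step receiving label i.
   The path is a ++ Special :: b with no special step in a, and p1 is a without
   its last step. The branches other than flatten and slide that return p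
   unchanged are not reached from an odd-special Dyck path, apart from the case
   of a path with no special step. *)
Definition E (i : nat) (p : seq step) : seq step :=
  if has is_special p then
    let k := find is_special p in
    let a := take k p in
    let b := drop k.+1 p in
    let p1 := take k.-1 p in
    match ohead (rev a) with
    | Some Up => p1 ++ Horiz i :: b
    | Some Down =>
        if matching_up p1 is Some j then
          take j p1 ++ Horiz i :: drop j.+1 p1 ++ Down :: b
        else p
    | _ => p
    end
  else p.

Definition final_path (p : seq step) : seq step :=
  foldl (fun q i => E i q) p (iota 1 (count is_special p)).

Definition horiz_labels (p : seq step) : seq nat :=
  pmap (fun s => if s is Horiz i then Some i else None) p.

(* The permutation pi(P), in one-line notation. *)
Definition path_perm (p : seq step) : seq nat := horiz_labels (final_path p).

(* Elements of 'I_m are shifted by one, since pi(P) permutes {1, ..., m}. *)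
Definition one_line (m : nat) (pi : 'S_m) : seq nat :=
  [seq (nat_of_ord (pi i)).+1 | i <- enum 'I_m].

Definition avoids231 (m : nat) (pi : 'S_m) : Prop :=
  forall i j k : 'I_m, i < j -> j < k -> ~~ ((pi k < pi i) && (pi i < pi j)).

(* Main.v *)
(* The maximum n of a 231-avoiding word splits it as l n r with every letter of
   l below every letter of r. If p and q are paths for l and r, then
   p U U q D d is a path for l n r: its last special step is treated last, and
   once q has become q', E slides U q' D d into HH q' D, which puts the new
   horizontal step exactly between those of p and those of q. The extra U keeps
   the parity of the heights in q. *)
Require Import Defs.
From mathcomp Require Import all_boot all_order all_algebra all_fingroup.
From mathcomp Require Import zify.

Set Implicit Arguments.
Unset Strict Implicit.
Unset Printing Implicit Defensive.

Import Order.TTheory GRing.Theory Num.Theory.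

Lemma height_cat (p q : seq step) : height (p ++ q) = (height p + height q)%R.
Proof. rewrite /height !count_cat; lia. Qed.

Lemma height_cons (s : step) (p : seq step) :
  height (s :: p) = (height [:: s] + height p)%R.
Proof. exact: (height_cat [:: s]). Qed.

Lemma take_cat_sub (T : Type) (j : nat) (p q : seq T) :
  take j (p ++ q) = take j p ++ take (j - size p) q.
Proof.
rewrite take_cat; case: ltnP => [lt_jp|le_pj]; last by rewrite (take_oversize le_pj).
by rewrite (eqP (ltnW lt_jp)) take0 cats0.
Qed.

Lemma height_take_cat (j : nat) (p q : seq step) :
  height (take j (p ++ q)) = (height (take j p) + height (take (j - size p) q))%R.
Proof. by rewrite take_cat_sub height_cat. Qed.

(** Letting [j] range beyond the length costs nothing, as [take] saturates, and spares range
    conditions under concatenation. *)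
Definition excursion (p : seq step) : Prop :=
  height p = 0%R /\ forall j, (0 <= height (take j p))%R.

Lemma lattice_path_excursion (p : seq step) : excursion p -> lattice_path p.
Proof. by case=> h0 hj; rewrite /lattice_path h0 eqxx; apply/allP=> j _. Qed.

Lemma excursion_cat (p q : seq step) :
  excursion p -> excursion q -> excursion (p ++ q).
Proof.
move=> [hp hjp] [hq hjq]; split; first by rewrite height_cat hp hq.
by move=> j; rewrite height_take_cat addr_ge0.
Qed.

Lemma excursion_horiz (i : nat) (p : seq step) :
  excursion p -> excursion (Horiz i :: p).
Proof. by apply: (@excursion_cat [:: Horiz i]); split=> // -[]. Qed.

Lemma excursion_arch (p : seq step) (s : step) :
  is_down s -> excursion p -> excursion (Up :: rcons p s).
Proof.
move=> s_down [hp hjp].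
have hs : height [:: s] = (- 1)%R by case: s s_down.
have hU : height [:: Up] = 1%R by [].
split; first by rewrite height_cons -cats1 height_cat hp hs.
case=> [|j] //; rewrite [take _ _]/= height_cons -cats1 height_take_cat hU.
have := hjp j.
have h0 : height [::] = 0%R by [].
by case: (j - size p) => [|k]; rewrite /= ?hs ?h0; lia.
Qed.

Definition special_at_odd (p : seq step) : Prop :=
  forall j, is_special (nth Down p j) -> odd `|height (take j p)|.

(** A prefix of even height does not change the parity of the heights in [q]; it need not be an
    excursion. *)
Lemma special_at_odd_cat (p q : seq step) :
    ~~ odd `|height p| -> special_at_odd p -> special_at_odd q ->
  special_at_odd (p ++ q).
Proof.
move=> even_p odd_p odd_q j; rewrite nth_cat take_cat; case: ltnP => _.
  exact: odd_p.
by move/odd_q; rewrite height_cat; lia.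
Qed.

(** Since [f] returns to its starting level without going below it, the [Up] before [f] matches the
    [Down] after it. *)
Lemma slide (i : nat) (a f b : seq step) :
    ~~ has is_special a -> ~~ has is_special f -> excursion f ->
  E i (a ++ Up :: f ++ Down :: Special :: b) = a ++ Horiz i :: f ++ Down :: b.
Proof.
move=> a_ns f_ns [hf hjf].
set c := a ++ Up :: f.
have -> : a ++ Up :: f ++ Down :: Special :: b = rcons c Down ++ Special :: b.
  by rewrite cat_rcons /c -catA.
have c_ns : ~~ has is_special (rcons c Down).
  by rewrite has_rcons /= /c has_cat /= negb_or a_ns.
rewrite /E has_cat orbT find_cat (negbTE c_ns) /= addn0.
rewrite take_size_cat // rev_rcons /= -[X in drop _ X]cat_rcons.
rewrite drop_size_cat ?size_rcons // cat_rcons take_size_cat //.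
suff -> : matching_up c = Some (size a).
  rewrite /c take_size_cat // -[X in drop _ X]cat_rcons.
  by rewrite drop_size_cat ?size_rcons.
(* The candidate positions lie in [a], at [size a], or in [f]; the last one is [size a] as soon as
   [f] contributes none. *)
rewrite /matching_up /c size_cat iotaD filter_cat /= add0n.
rewrite nth_cat ltnn subnn /=.
have hU : height [:: Up] = 1%R by [].
have hc : height (a ++ Up :: f) = (height a + 1)%R.
  by rewrite height_cat height_cons hf hU addr0.
have -> : height (take (size a).+1 (a ++ Up :: f)) = (height a + 1)%R.
  by rewrite -cat_rcons take_size_cat ?size_rcons // -cats1 height_cat hU.
rewrite hc eqxx rev_cat.
set t := filter _ (iota (size a).+1 _).
suff -> : t = [::] by rewrite rev_cons.
(* An upstep of f ending at the level where f starts would leave from below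
   that level. *)
apply/eqP; rewrite -(negbK (_ == _)) -has_filter; apply/hasPn=> j.
rewrite mem_iota => /andP[lt_aj lt_j]; apply/negP=> /andP[].
have [k ->] : exists k, j = size (rcons a Up) + k.
  by exists (j - (size a).+1); rewrite size_rcons subnKC.
rewrite -cat_rcons nth_cat ltnNge leq_addr /= addKn => up_k /eqP.
rewrite take_cat -addnS ltnNge leq_addr addKn.
(* Past the end of [f] the default value [Down] is not an upstep. *)
have lt_k : k < size f.
  by apply: contraLR up_k; rewrite -leqNgt => /(nth_default Down) ->.
rewrite (take_nth Down) // -[rcons (take _ _) _]cats1 !height_cat -cats1.
have -> : height [:: nth Down f k] = 1%R by case: (nth _ _ _) up_k.
by rewrite height_cat hU; have := hjf k; lia.
Qed.

(* Quantifying over the surroundings [a] and [b] of [p] makes the notion usable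
   for a subpath: [E] treats the special steps of [p] as if [p] stood alone. *)
Definition realizes (w : seq nat) (p : seq step) : Prop :=
  exists f,
    [/\ ~~ has is_special f, excursion f, horiz_labels f = w &
     forall a b, ~~ has is_special a ->
       foldl (fun q i => E i q) (a ++ p ++ b) (sort leq w) = a ++ f ++ b].

Lemma horiz_labels_cat (p q : seq step) :
  horiz_labels (p ++ q) = horiz_labels p ++ horiz_labels q.
Proof. exact: pmap_cat. Qed.

(** The hypothesis on [sort] makes the order of the labels agree with the order in which leftmost
    special steps are met: those of [p], those of [q], then the final one. *)
Lemma realizes_cons_max (l r : seq nat) (n : nat) (p q : seq step) :
    sort leq (l ++ n :: r) = sort leq l ++ sort leq r ++ [:: n] ->
    realizes l p -> realizes r q ->
  realizes (l ++ n :: r) (p ++ Up :: Up :: q ++ [:: Down; Special]).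
Proof.
move=> sortE [f [f_ns f_exc f_lab Ef]] [g [g_ns g_exc g_lab Eg]].
(* The slide consumes the second [Up]; the first one stays, closed by the new [Down]. *)
exists (f ++ Up :: rcons (Horiz n :: g) Down); split.
- by rewrite has_cat /= has_rcons /= negb_or f_ns.
- by apply/excursion_cat/excursion_arch/excursion_horiz.
- rewrite horiz_labels_cat f_lab -[Up :: _]/([:: Up; Horiz n] ++ rcons g Down).
  by rewrite -cats1 !horiz_labels_cat g_lab cats0.
move=> a b a_ns; rewrite sortE !foldl_cat -!catA /= Ef //.
have -> : a ++ f ++ Up :: Up :: (q ++ [:: Down; Special]) ++ b
   = (a ++ f ++ [:: Up; Up]) ++ q ++ Down :: Special :: b by rewrite -!catA.
rewrite Eg; last by rewrite !has_cat /= !negb_or a_ns f_ns.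
(* Both upsteps were context while [q] was transformed; now the second is released as the one to be
   slid. *)
have -> : (a ++ f ++ [:: Up; Up]) ++ g ++ Down :: Special :: b
  = (a ++ f ++ [:: Up]) ++ Up :: g ++ Down :: Special :: b by rewrite -!catA.
rewrite /= slide //; last by rewrite !has_cat /= !negb_or a_ns f_ns.
by rewrite -cats1 -!catA.
Qed.

(** Stated for words because the induction passes to factors whose letters need not form an initial
    segment. *)
Definition word_avoids231 (w : seq nat) : Prop :=
  forall x y z, subseq [:: x; y; z] w -> ~~ ((z < x) && (x < y)).

Lemma word_avoids231_subseq (v w : seq nat) :
  subseq v w -> word_avoids231 w -> word_avoids231 v.
Proof. by move=> vw w_av x y z /subseq_trans/(_ vw)/w_av. Qed.

Lemma seq_max_decomp (w : seq nat) : w != [::] ->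
  exists l n r, w = l ++ n :: r /\ all (leq^~ n) (l ++ r).
Proof.
move=> w_n0; have : perm_eq (sort leq w) w by rewrite perm_sort.
have := sort_sorted leq_total w.
case/lastP: (sort _ _) => [|s n].
  by move=> _ /perm_size/esym/size0nil w0; rewrite w0 in w_n0.
rewrite (sorted_pairwise leq_trans) pairwise_rcons => /andP[s_le _] wP.
have n_w : n \in w by rewrite -(perm_mem wP) mem_rcons mem_head.
case/splitPr: n_w wP {w_n0} => l r wP; exists l, n, r; split=> //.
have /perm_all <- // : perm_eq s (l ++ r).
rewrite -(perm_cons n) -perm_rcons; apply: (perm_trans wP).
by rewrite (perm_catCA l [:: n] r).
Qed.

(** A letter of [l] above a letter of [r] would form a 231 with [n] between them. *)
Lemma sort_avoids231 (l r : seq nat) (n : nat) :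
    uniq (l ++ n :: r) -> word_avoids231 (l ++ n :: r) ->
    all (leq^~ n) (l ++ r) ->
  sort leq (l ++ n :: r) = sort leq l ++ sort leq r ++ [:: n].
Proof.
move=> w_uniq w_av; rewrite all_cat => /andP[/allP l_le /allP r_le].
apply: (sorted_eq leq_trans anti_leq).
- exact/sort_sorted/leq_total.
- rewrite (sorted_pairwise leq_trans) !pairwise_cat /= -!(sorted_pairwise leq_trans).
  rewrite !sort_sorted ?allrel_catr; do ?exact: leq_total.
  rewrite !andbT /= -andbA; apply/and3P; split; apply/allrelP.
  + move=> x z; rewrite !mem_sort => xl zr; rewrite leqNgt.
    have: ~~ ((z < x) && (x < n)).
      apply: w_av; rewrite -[[:: x; n; z]]/([:: x] ++ n :: [:: z]).
      by rewrite cat_subseq ?sub1seq //= eqxx sub1seq.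
    (* If [x < n] fails, then [x = n], and [n] would occur twice in the word. *)
    rewrite negb_and => /orP[//|]; rewrite ltn_neqAle l_le // andbT negbK.
    move=> /eqP xn; move: w_uniq; rewrite cat_uniq -xn /= xl.
    by rewrite andbF.
  + by move=> x y; rewrite mem_sort inE => xl /eqP ->; exact: l_le.
  + by move=> x y; rewrite mem_sort inE => xr /eqP ->; exact: r_le.
- rewrite perm_sort perm_sym; apply: perm_cat; first by rewrite perm_sort.
  by rewrite cats1 perm_rcons perm_cons perm_sort.
Qed.

(** Strong induction on the length, splitting at the maximum. The number of special steps is
    recorded because it fixes how often [final_path] applies [E]. *)
Lemma avoids231_realized (w : seq nat) :
    uniq w -> word_avoids231 w ->
  exists p, [/\ excursion p, ~~ has is_horiz p, special_at_odd p,
    count is_special p = size w & realizes w p].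
Proof.
have [k] := ubnP (size w); elim: k w => // k IHk w lt_wk w_uniq w_av.
have [-> |] := eqVneq w [::].
  exists [::]; split=> //; first by case.
  by exists [::]; split.
case/seq_max_decomp=> l [n [r [w_eq le_n]]]; subst w.
have sub_l : subseq l (l ++ n :: r) by exact: prefix_subseq.
have sub_r : subseq r (l ++ n :: r).
  exact: subseq_trans (subseq_cons r n) (suffix_subseq _ _).
move: (lt_wk); rewrite size_cat /= => sz.
have [|||p [p_exc p_h p_odd p_sp p_real]] := IHk l; first lia.
- exact: subseq_uniq w_uniq.
- exact: word_avoids231_subseq w_av.
have [|||q [q_exc q_h q_odd q_sp q_real]] := IHk r; first lia.
- exact: subseq_uniq w_uniq.
- exact: word_avoids231_subseq w_av.
exists (p ++ Up :: Up :: q ++ [:: Down; Special]); split.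
- apply: excursion_cat => //.
  have -> : Up :: Up :: q ++ [:: Down; Special]
    = Up :: rcons (Up :: rcons q Down) Special by rewrite -!cats1 /= -catA.
  by do 2!apply: excursion_arch => //.
- by rewrite !has_cat /= has_cat /= !negb_or p_h q_h.
- apply: special_at_odd_cat => //; first by rewrite p_exc.1.
  apply: (@special_at_odd_cat [:: Up; Up]) => //; first by case=> [|[|[]]].
  apply: special_at_odd_cat => //; first by rewrite q_exc.1.
  (* Relative to the start of [[:: Down; Special]], the special step leaves from height -1, which is
     odd. *)
  by case=> [|[|[]]].
- by rewrite count_cat /= count_cat /= p_sp q_sp; lia.
- by apply: realizes_cons_max => //; exact: sort_avoids231.
Qed.

Lemma word_avoids231_one_line (m : nat) (pi : 'S_m) :
  avoids231 pi -> word_avoids231 (one_line pi).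
Proof.
move=> pi_av x y z /subseqP[b _]; rewrite -map_mask.
(* The enumeration is increasing, so the three selected letters sit at increasing indices. *)
have: sorted (fun i j : 'I_m => i < j) (mask b (enum 'I_m)).
  apply: (subseq_sorted _ (mask_subseq _ _)).
    by move=> j i k; exact: ltn_trans.
  by have := iota_ltn_sorted 0 m; rewrite -val_enum_ord sorted_map.
case: (mask _ _) => [|i [|j [|k [|]]]] //= /and3P[lt_ij lt_jk _] [-> -> ->].
exact: pi_av lt_ij lt_jk.
Qed.

(** This identifies the sorted labels of [realizes] with the labels 1 to [m] that [final_path] hands
    out. *)
Lemma sort_one_line (m : nat) (pi : 'S_m) : sort leq (one_line pi) = iota 1 m.
Proof.
apply: (sorted_eq leq_trans anti_leq).
- exact/sort_sorted/leq_total.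
- exact: iota_sorted.
rewrite perm_sort; apply: uniq_perm; rewrite ?iota_uniq //.
  by rewrite map_inj_uniq ?enum_uniq // => i j [/val_inj/perm_inj].
move=> n; rewrite mem_iota; apply/mapP/andP => [[i _ ->]|[n_gt0]].
  by split=> //; rewrite add1n ltnS.
rewrite add1n ltnS => n_le.
have lt_nm : n.-1 < m by rewrite prednK.
exists ((pi^-1)%g (Ordinal lt_nm)); first by rewrite mem_enum.
by rewrite permKV /= prednK.
Qed.

Theorem theorem11 (m : nat) (pi : 'S_m) (hpi : avoids231 pi) :
  exists P : seq step, odd_special_dyck_path P /\ path_perm P = one_line pi.
Proof.
have pi_uniq : uniq (one_line pi).
  by rewrite -(sort_uniq leq) sort_one_line iota_uniq.
have [P [P_exc P_h P_odd P_sp [f [_ _ f_lab Ef]]]] :=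
  avoids231_realized pi_uniq (word_avoids231_one_line hpi).
exists P; split.
  rewrite /odd_special_dyck_path /dyck_path lattice_path_excursion // P_h.
  by apply/allP=> j _; apply/implyP/P_odd.
rewrite /path_perm /final_path P_sp /one_line size_map size_enum_ord.
(* Empty surroundings turn [realizes] into a statement about [P] alone. *)
by have := Ef [::] [::] isT; rewrite sort_one_line !cats0 /= => ->.
Qed.
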